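(* Let $q$ be a prime power, let $\alpha_1,\dots,\alpha_n\in\mathbb{F}_q$ be distinct, and let $k,r$ be integers with $1\le r\le k-1$ and $k<n$. Let $H_{r,k}$ be the $(n-k)\times n$ matrix whose first $n-k-1$ rows are $$(u_1\alpha_1^{e},u_2\alpha_2^{e},\dots,u_n\alpha_n^{e}),\qquad e=0,1,\dots,n-k-2,$$ and whose last row is $$(u_1\Lambda_{r,1},u_2\Lambda_{r,2},\dots,u_n\Lambda_{r,n}).$$ Then $H_{r,k}$ is a parity check matrix for the code $C_{r,k}$ generated by $G_{r,k}$.
   Context: For distinct $\alpha_1,\dots,\alpha_n\in\mathbb{F}_q$ and $1\le r\le k-1$, $G_{r,k}$ is the $k\times n$ matrix whose rows are $(\alpha_1^e,\alpha_2^e,\dots,\alpha_n^e)$ for $e=0,1,\dots,k-r-1,k-r+1,\dots,k$ in this order (all exponents from $0$ to $k$ except $k-r$; convention $0^0=1$), and $C_{r,k}$ is the linear code over $\mathbb{F}_q$ it generates. Notation: $u_i=\prod_{1\le j\le n,\ j\ne i}(\alpha_i-\alpha_j)^{-1}$ for $1\le i\le n$; $\sigma_t=\sum_{1\le j_1<\dots<j_t\le n}\alpha_{j_1}\cdots\alpha_{j_t}$ is the $t$-th elementary symmetric function of $\alpha_1,\dots,\alpha_n$, with $\sigma_0=1$; and $$\Lambda_{r,i}=\sum_{j=0}^r(-1)^j\sigma_j\,\alpha_i^{(n-k)+(r-1)-j}.$$ A parity check matrix of an $[n,k]$ code $C$ is an $(n-k)\times n$ matrix with linearly independent rows whose row space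 is the dual code $C^\perp$ (with respect to the standard bilinear form). *)

(* Defs.v *)
From HB Require Import structures.
From mathcomp Require Import all_boot all_order all_algebra.

Set Implicit Arguments.
Unset Strict Implicit.
Unset Printing Implicit Defensive.

Import GRing.Theory.

Local Open Scope ring_scope.

Definition row_code (F : finFieldType) (m n : nat) (A : 'M[F]_(m, n)) :
    {set 'rV[F]_n} :=
  [set v | (v <= A)%MS].

Definition dual_code (F : finFieldType) (n : nat) (C : {set 'rV[F]_n}) :
    {set 'rV[F]_n} :=
  [set v : 'rV[F]_n | [forall c in C, \sum_(i < n) c 0 i * v 0 i == 0]].

Definition is_linear_code (F : finFieldType) (n k : nat)
    (C : {set 'rV[F]_n}) : Prop :=
  exists2 G : 'M[F]_(k, n), row_free G & C = row_code G.

Definition is_parity_check (F : finFieldType) (n k : nat)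
    (C : {set 'rV[F]_n}) (H : 'M[F]_(n - k, n)) : Prop :=
  [/\ is_linear_code k C, row_free H & row_code H = dual_code C].

(* [bump h] enumerates in increasing order the naturals different from [h],
   so the exponents used are those from 0 to k except k - r. *)
Definition Gmx (F : finFieldType) (n : nat) (alpha : 'I_n -> F) (r k : nat) :
    'M[F]_(k, n) :=
  \matrix_(i < k, j < n) alpha j ^+ bump (k - r) i.

Definition u (F : finFieldType) (n : nat) (alpha : 'I_n -> F) (i : 'I_n) : F :=
  \prod_(j < n | j != i) (alpha i - alpha j)^-1.

Definition sigma (F : finFieldType) (n : nat) (alpha : 'I_n -> F) (t : nat) :
    F :=
  \sum_(A : {set 'I_n} | #|A| == t) \prod_(j in A) alpha j.

(* The natural-number subtractions are exact when k < n, 1 <= r and r < k. *)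
Definition Lambda (F : finFieldType) (n : nat) (alpha : 'I_n -> F)
    (r k : nat) (i : 'I_n) : F :=
  \sum_(0 <= j < r.+1)
    (-1) ^+ j * sigma alpha j * alpha i ^+ ((n - k) + (r - 1) - j).

Definition Hmx (F : finFieldType) (n : nat) (alpha : 'I_n -> F) (r k : nat) :
    'M[F]_(n - k, n) :=
  \matrix_(i < n - k, j < n)
    if (i < n - k - 1)%N then u alpha j * alpha j ^+ i
    else u alpha j * Lambda alpha r k j.

(* Main.v *)
(* By Lagrange interpolation, sum_j u_j p(alpha_j) is the coefficient of
   X^(n-1) in p whenever deg p < n, so it vanishes when deg p <= n - 2. Row i of
   H_{r,k} is (u_j P(alpha_j))_j for a polynomial P, so the orthogonality of H
   and G amounts to the vanishing of this functional at each X^e P, where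
   0 <= e <= k and e <> k - r. The degree of X^e P is at most n - 2 unless P is
   the polynomial of the last row and e > k - r. In that case X^e P is
   X^s (X^n - sigma_1 X^(n-1) + ... +- sigma_r X^(n-r)) with s = e - (k - r) - 1;
   the second factor is an initial segment of m = prod_j (X - alpha_j), and
   reducing by X^s m leaves a polynomial of degree at most s + n - r - 1, hence
   at most n - 2, with the same values at the alpha_j. The rows of G and of H
   come from polynomials of distinct degrees less than n, so both matrices have
   full rank, and the dimension count turns orthogonality into duality. *)
Require Import Defs.
From mathcomp Require Import all_boot all_order all_algebra.
From mathcomp Require Import zify.

Set Implicit Arguments.
Unset Strict Implicit.
Unset Printing Implicit Defensive.

Import GRing.Theory.

Local Open Scope ring_scope.

Lemma poly_eq0_values (F : fieldType) (n : nat) (alpha : 'I_n -> F)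
    (p : {poly F}) :
  injective alpha -> (size p <= n)%N -> (forall j, p.[alpha j] = 0) -> p = 0.
Proof.
move=> alpha_inj szp p0; apply/eqP/contraT => p_neq0.
have := @max_poly_roots _ p (map alpha (enum 'I_n)) p_neq0.
rewrite map_inj_uniq // enum_uniq size_map size_enum_ord ltnNge szp.
suff -> : all (root p) (map alpha (enum 'I_n)) by move/(_ isT isT).
by apply/allP => _ /mapP[j _ ->]; apply/rootP.
Qed.

(** Among the terms with nonzero coefficient, the one of largest size is unique, so nothing cancels
    its leading term. *)
Lemma sum_size_inj_eq0 (F : fieldType) (m : nat) (P : 'I_m -> {poly F})
    (v : 'I_m -> F) :
  (forall i, P i != 0) -> injective (fun i => size (P i)) ->
  \sum_i v i *: P i = 0 -> forall i, v i = 0.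
Proof.
move=> P0 szP sum0 i0; apply/eqP/contraT => vi0.
pose i := [arg max_(i > i0 | v i != 0) size (P i)].
have [vi maxi] : v i != 0 /\ forall j, v j != 0 -> (size (P j) <= size (P i))%N.
  by rewrite /i; case: arg_maxnP.
have /eqP := congr1 (fun p : {poly F} => p`_(size (P i)).-1) sum0.
rewrite coef_sum coef0 (bigD1 i) //= big1 ?addr0 => [|j ji].
  by rewrite coefZ mulf_eq0 (negPf vi) -/(lead_coef _) lead_coef_eq0 (negPf (P0 i)).
rewrite coefZ; have [->|vj] := eqVneq (v j) 0; first by rewrite mul0r.
rewrite nth_default ?mulr0 //.
have: (size (P j) < size (P i))%N.
  by rewrite ltn_neqAle maxi // andbT; apply: contra_neq ji; exact: szP.
by move=> lt_ji; rewrite -ltnS (ltn_predK lt_ji).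
Qed.

(** Once the nonzero weights are cancelled, a vanishing combination of rows is a combination of the
    [P i] with [n] distinct roots and size at most [n], hence zero. *)
Lemma row_free_values (F : fieldType) (m n : nat) (alpha w : 'I_n -> F)
    (P : 'I_m -> {poly F}) :
  injective alpha -> (forall j, w j != 0) ->
  (forall i, P i != 0) -> (forall i, (size (P i) <= n)%N) ->
  injective (fun i => size (P i)) ->
  row_free (\matrix_(i < m, j < n) (w j * (P i).[alpha j])).
Proof.
move=> alpha_inj w0 P0 szn szP; apply: inj_row_free => v vA0.
apply/rowP => i; rewrite mxE.
apply: (sum_size_inj_eq0 P0 szP (v := fun i => v 0 i)).
apply: (poly_eq0_values alpha_inj) => [|j].
  apply: (leq_trans (size_sum _ _ _)); apply/bigmax_leqP => l _.
  exact: leq_trans (size_scale_leq _ _) (szn l).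
apply: (mulfI (w0 j)); rewrite mulr0.
have /rowP/(_ j) := vA0; rewrite !mxE => <-.
rewrite horner_sum mulr_sumr; apply: eq_bigr => l _.
by rewrite mxE hornerZ mulrCA.
Qed.

Lemma u_neq0 (F : finFieldType) (n : nat) (alpha : 'I_n -> F) (i : 'I_n) :
  injective alpha -> u alpha i != 0.
Proof.
move=> alpha_inj; apply/prodf_neq0 => j ji.
by rewrite invr_eq0 subr_eq0 (inj_eq alpha_inj) eq_sym.
Qed.

Lemma sum_u_horner (F : finFieldType) (n : nat) (alpha : 'I_n -> F)
    (p : {poly F}) :
  injective alpha -> (size p <= n)%N ->
  \sum_i u alpha i * p.[alpha i] = p`_n.-1.
Proof.
move=> alpha_inj szp.
pose L i := \prod_(j < n | j != i) ('X - (alpha j)%:P).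
have szL i : size (L i) = n.
  rewrite /L -big_enum size_prod_XsubC -cardE cardC1.
  by rewrite card_ord prednK //; exact: leq_ltn_trans (ltn_ord i).
have monL i : L i \is monic by apply: monic_prod => j _; exact: monicXsubC.
(* Lagrange's formula: [u alpha i] is the inverse of [L i] at [alpha i]. *)
have pE : p = \sum_i (u alpha i * p.[alpha i]) *: L i.
  apply/eqP; rewrite -subr_eq0; apply/eqP/(poly_eq0_values alpha_inj) => [|l].
    apply: leq_trans (size_polyD _ _) _; rewrite geq_max szp size_polyN /=.
    apply: (leq_trans (size_sum _ _ _)); apply/bigmax_leqP => i _.
    by apply: leq_trans (size_scale_leq _ _) _; rewrite szL.
  rewrite hornerD hornerN horner_sum (bigD1 l) //= big1 ?addr0 => [|i il].
    rewrite hornerZ mulrAC horner_prod /u -big_split /= big1 ?mul1r ?subrr //.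
    move=> j jl; rewrite hornerXsubC mulVf // subr_eq0 (inj_eq alpha_inj).
    by rewrite eq_sym.
  rewrite hornerZ horner_prod (bigD1 l) ?(eq_sym l) //= hornerXsubC subrr.
  by rewrite mul0r mulr0.
rewrite [in RHS]pE coef_sum; apply: eq_bigr => i _; rewrite coefZ.
by have /monicP := monL i; rewrite lead_coefE szL => ->; rewrite mulr1.
Qed.

Lemma prod_XsubC_sigma (F : finFieldType) (n : nat) (alpha : 'I_n -> F) :
  \prod_i ('X - (alpha i)%:P) =
  \sum_(0 <= t < n.+1) ((-1) ^+ t * sigma alpha t) *: 'X^(n - t).
Proof.
(* With the constant written first, the set [A] in the expansion collects the factors that
   contribute [- alpha i]; the terms are then grouped by [#|A|]. *)
under eq_bigr do rewrite addrC.
rewrite bigA_distr big_mkord.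
rewrite (partition_big (fun A : {set 'I_n} => inord #|A| : 'I_n.+1) predT) //=.
apply: eq_bigr => t _; rewrite /sigma mulr_sumr scaler_suml.
have cardE (A : {set 'I_n}) : (inord #|A| == t :> 'I_n.+1) = (#|A| == t).
  by rewrite -val_eqE /= inordK // ltnS -[X in (_ <= X)%N]card_ord max_card.
apply: eq_big => // A; rewrite cardE => /eqP cA.
rewrite -cA -[X in 'X^(X - _)]card_ord.
rewrite (bigID (mem A)) /=; under eq_bigr => i -> do [].
under [X in _ * X]eq_bigr => i /negPf -> do [].
rewrite prodrN prodr_const -rmorph_prod /=.
rewrite -mul_polyC rmorphM /= rmorphXn /= rmorphN1.
by congr (_ * 'X^_); rewrite -(cardC (mem A)) addKn.
Qed.

Definition Hpoly (F : finFieldType) (n : nat) (alpha : 'I_n -> F) (r k : nat)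
    (i : nat) : {poly F} :=
  if (i < n - k - 1)%N then 'X^i
  else \sum_(0 <= j < r.+1)
         ((-1) ^+ j * sigma alpha j) *: 'X^((n - k) + (r - 1) - j).

Lemma Hmx_Hpoly (F : finFieldType) (n : nat) (alpha : 'I_n -> F) (r k : nat) :
  Hmx alpha r k =
  \matrix_(i, j) (u alpha j * (Hpoly alpha r k i).[alpha j]).
Proof.
apply/matrixP => i j; rewrite !mxE /Hpoly; case: ifP => _.
  by rewrite hornerXn.
rewrite horner_sum; congr (_ * _); apply: eq_bigr => l _.
by rewrite hornerZ hornerXn.
Qed.

Lemma sigma0 (F : finFieldType) (n : nat) (alpha : 'I_n -> F) :
  sigma alpha 0 = 1.
Proof.
rewrite /sigma (big_pred1 set0) ?big_set0 // => A.
by rewrite cards_eq0.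
Qed.

Lemma size_Hpoly (F : finFieldType) (n : nat) (alpha : 'I_n -> F)
    (r k i : nat) :
  (0 < r)%N -> (k < n)%N ->
  size (Hpoly alpha r k i) = (if (i < n - k - 1)%N then i.+1 else n - k + r)%N.
Proof.
move=> r0 kn; rewrite /Hpoly; case: ifP => _; first by rewrite size_polyXn.
have szX a : size ('X^a : {poly F}) = a.+1 by rewrite size_polyXn.
(* The term [j = 0] is monic since [sigma alpha 0 = 1], and it dominates the others. *)
rewrite big_nat_recl // sigma0 expr0 mulr1 scale1r size_polyDl ?szX; first by lia.
rewrite big_mkord ltnS; apply: (leq_trans (size_sum _ _ _)).
apply/bigmax_leqP => j _; apply: leq_trans (size_scale_leq _ _) _.
rewrite szX; lia.
Qed.

Lemma sum_u_Hpoly (F : finFieldType) (n : nat) (alpha : 'I_n -> F)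
    (r k e i : nat) :
  injective alpha -> (0 < r < k)%N -> (k < n)%N -> (e <= k)%N ->
  e != (k - r)%N -> (i < n - k)%N ->
  \sum_j u alpha j * ('X^e * Hpoly alpha r k i).[alpha j] = 0.
Proof.
move=> alpha_inj /andP[r0 rk] kn ek ekr ik.
have sum0 (p : {poly F}) : (size p <= n.-1)%N ->
    \sum_j u alpha j * p.[alpha j] = 0.
  move=> szp; rewrite sum_u_horner //; first by rewrite nth_default.
  exact: leq_trans szp (leq_pred n).
have := size_Hpoly alpha i r0 kn.
case: ifPn => i_lt szH.
  apply: sum0; rewrite mulrC size_mulXn; last by rewrite -size_poly_gt0 szH.
  rewrite szH; lia.
have [e_lt|e_ge] := ltnP e (k - r).
  apply: sum0; rewrite mulrC size_mulXn; last by rewrite -size_poly_gt0 szH; lia.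
  rewrite szH; lia.
(* Now [e > k - r], so the predecessor is exact and [s + n = e + (n - k) + (r - 1)]: the leading
   terms match. *)
pose s := (e - (k - r)).-1.
pose tail : {poly F} := \sum_(r.+1 <= t < n.+1)
  ((-1) ^+ t * sigma alpha t) *: 'X^(n - t).
have -> : 'X^e * Hpoly alpha r k i
    = 'X^s * \prod_j ('X - (alpha j)%:P) - 'X^s * tail.
  rewrite prod_XsubC_sigma (big_cat_nat (n := r.+1)) //=; last by lia.
  rewrite mulrDr addrK /Hpoly (negPf i_lt) !big_mkord !mulr_sumr.
  apply: eq_bigr => j _; rewrite -!scalerAr -!exprD; congr (_ *: 'X^_).
  rewrite /s; have := ltn_ord j; lia.
rewrite (eq_bigr (fun j => u alpha j * (- ('X^s * tail)).[alpha j])); last first.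
  move=> j _; rewrite hornerD [X in X + _]hornerM horner_prod.
  by rewrite (bigD1 j) //= hornerXsubC subrr mul0r mulr0 add0r.
apply: sum0; rewrite size_polyN.
have [->|tail0] := eqVneq tail 0; first by rewrite mulr0 size_poly0.
rewrite mulrC size_mulXn //.
have : (size tail <= n - r)%N.
  apply: (leq_trans (size_sum _ _ _)); apply/bigmax_leqP_seq => t.
  rewrite mem_index_iota => t_int _; apply: leq_trans (size_scale_leq _ _) _.
  rewrite size_polyXn; lia.
(* Since [e <= k], [s] is at most [r - 1], which gives the bound [n - 1]. *)
move=> sz_tail; apply: leq_trans (leq_add (leqnn s) sz_tail) _; rewrite /s; lia.
Qed.

Lemma row_free_Gmx (F : finFieldType) (n : nat) (alpha : 'I_n -> F)
    (r k : nat) :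
  injective alpha -> (k < n)%N -> row_free (Gmx alpha r k).
Proof.
move=> alpha_inj kn.
have -> : Gmx alpha r k =
    \matrix_(i < k, j < n) (1 * ('X^(bump (k - r) i)).[alpha j]).
  by apply/matrixP => i j; rewrite !mxE hornerXn mul1r.
apply: row_free_values => // [j|i|i|i i'].
- exact: oner_neq0.
- by rewrite -size_poly_gt0 size_polyXn.
- rewrite size_polyXn /bump; have := ltn_ord i; lia.
- by rewrite !size_polyXn => -[] /(can_inj (bumpK _)) /val_inj.
Qed.

Lemma row_free_Hmx (F : finFieldType) (n : nat) (alpha : 'I_n -> F)
    (r k : nat) :
  injective alpha -> (0 < r < k)%N -> (k < n)%N -> row_free (Hmx alpha r k).
Proof.
move=> alpha_inj /andP[r0 rk] kn; rewrite Hmx_Hpoly.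
apply: row_free_values => // [j|i|i|i i'].
- exact: u_neq0.
- rewrite -size_poly_gt0 size_Hpoly //; case: ifP; lia.
- rewrite size_Hpoly //; case: ifP; lia.
(* The sizes are 1, ..., [n - k - 1], followed by the larger [n - k + r]. *)
- rewrite !size_Hpoly // => eq_sz; apply: val_inj => /=; move: eq_sz.
  have := ltn_ord i; have := ltn_ord i'; case: ifP; case: ifP; lia.
Qed.

Lemma mulmx_Gmx_Hmx (F : finFieldType) (n : nat) (alpha : 'I_n -> F)
    (r k : nat) :
  injective alpha -> (0 < r < k)%N -> (k < n)%N ->
  Gmx alpha r k *m (Hmx alpha r k)^T = 0.
Proof.
move=> alpha_inj rk kn; apply/matrixP => i l; rewrite !mxE Hmx_Hpoly.
rewrite -[RHS](@sum_u_Hpoly _ _ alpha r k (bump (k - r) i) l) //.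
- by apply: eq_bigr => j _; rewrite !mxE hornerM hornerXn mulrCA.
- rewrite /bump; have := ltn_ord i; lia.
- by rewrite eq_sym neq_bump.
Qed.

(** Orthogonality puts the rows of [H] in the kernel of [G^T]; that kernel has dimension
    [n - k = l], the rank of [H], so the two spaces coincide. *)
Lemma row_code_dual (F : finFieldType) (n k l : nat) (G : 'M[F]_(k, n))
    (H : 'M[F]_(l, n)) :
  row_free G -> row_free H -> G *m H^T = 0 -> (k + l = n)%N ->
  row_code H = dual_code (row_code G).
Proof.
move=> /eqP rkG /eqP rkH GH kl.
have HG : (H <= kermx G^T)%MS.
  by apply/sub_kermxP; rewrite -[H]trmxK -trmx_mul GH trmx0.
have eqHG : (H :=: kermx G^T)%MS.
  apply/eqmxP; rewrite HG -(mxrank_leqif_sup HG).2 mxrank_ker mxrank_tr rkG rkH.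
  by apply/eqP; lia.
apply/setP => v; rewrite !inE eqHG.
apply/sub_kermxP/forall_inP => [vG c|vdual].
  rewrite inE => /submxP[w ->]; apply/eqP.
  transitivity ((w *m G *m v^T) 0 0).
    by rewrite mxE; apply: eq_bigr => i _; rewrite [v^T _ _]mxE.
  by rewrite -mulmxA -[G]trmxK -trmx_mul vG trmx0 mulmx0 mxE.
apply/rowP => i; rewrite !mxE.
(* Testing a dual vector against the rows of [G] alone already places it in the kernel. *)
have rG : row i G \in row_code G by rewrite inE row_sub.
rewrite -[RHS](eqP (vdual _ rG)).
by apply: eq_bigr => j _; rewrite !mxE mulrC.
Qed.

Theorem theorem3p3 (F : finFieldType) (n k r : nat) (alpha : 'I_n -> F)
    (alpha_inj : injective alpha)
    (hr : (1 <= r <= k - 1)%N) (hkn : (k < n)%N) :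
  is_parity_check (row_code (Gmx alpha r k)) (Hmx alpha r k).
Proof.
have rk : (0 < r < k)%N by lia.
split.
- by exists (Gmx alpha r k) => //; exact: row_free_Gmx.
- exact: row_free_Hmx.
- apply: row_code_dual; rewrite ?row_free_Gmx ?row_free_Hmx ?mulmx_Gmx_Hmx //.
  lia.
Qed.
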